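(* Let $p>0$. The index $S_p$ has the cloning property: for every $N\ge 1$ and every vector $Y=(Y_1,\dots,Y_N)$ with positive entries, one has $$S_p(Y)=S_p(Y')=S_p((Y,Y)),$$ where $Y'=(Y_1,Y_1,Y_2,Y_2,\dots,Y_N,Y_N)$ and $(Y,Y)=(Y_1,\dots,Y_N,Y_1,\dots,Y_N)$ are vectors with $2N$ entries.
   Context: For a vector $Y=(Y_1,\dots,Y_N)$ with positive entries, let $r$ be a permutation of $\{1,\dots,N\}$ with $Y_{r_1}\le Y_{r_2}\le\dots\le Y_{r_N}$, and let $\bar Y=\frac1N\sum_{i=1}^N Y_i$. The Lorenz curve $L_Y:[0,1]\to\mathbb{R}$ is the piecewise linear interpolation of the points $\big(\frac kN,\sum_{i=1}^kY_{r_i}\big)$, $k=0,\dots,N$, and the dual Lorenz curve $L_Y^c:[0,1]\to\mathbb{R}$ is the piecewise linear interpolation of the points $\big(\frac kN,\sum_{i=1}^kY_{r_{N+1-i}}\big)$, $k=0,\dots,N$. For $p>0$, $$S_p(Y)=\frac{1}{N\bar Y}\Big(\int_0^1|L_Y^c(t)-L_Y(t)|^p\,dt\Big)^{1/p}.$$ The same definition is applied to vectors of length $2N$ (with $N$ replaced by $2N$). *)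

(* Defs.v *)
From HB Require Import structures.
From mathcomp Require Import all_boot all_order all_algebra all_fingroup.
From mathcomp Require Import all_classical all_reals all_analysis.
Set Implicit Arguments.
Unset Strict Implicit.
Unset Printing Implicit Defensive.
Import Order.TTheory GRing.Theory Num.Theory.
Import numFieldNormedType.Exports.
Local Open Scope classical_set_scope.
Local Open Scope ring_scope.

(* The chain Y_(r 0) <= Y_(r 1) <= ... <= Y_(r (N-1)); indices start at 0. *)
Definition sorting {R : realType} {N : nat} (Y : 'rV[R]_N) (r : 'S_N) : bool :=
  sorted <=%R [seq Y 0 (r i) | i <- enum 'I_N].

Lemma sorting_exists {R : realType} {N : nat} (Y : 'rV[R]_N) :
  exists r : 'S_N, sorting Y r.
Proof.
pose t := [tuple Y 0 i | i < N].
have /tuple_permP[r rE] : perm_eq (sort <=%R t) t by rewrite perm_sort.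
exists r; rewrite /sorting.
have -> : [seq Y 0 (r i) | i <- enum 'I_N] = sort <=%R t.
  by rewrite rE; apply: eq_map => i; rewrite tnth_mktuple.
exact/sort_sorted/le_total.
Qed.

Definition sorting_perm {R : realType} {N : nat} (Y : 'rV[R]_N) : 'S_N :=
  xchoose (sorting_exists Y).

Lemma sorting_permP {R : realType} {N : nat} (Y : 'rV[R]_N) :
  sorting Y (sorting_perm Y).
Proof. exact: (xchooseP (sorting_exists Y)). Qed.

(* With ties the sorting permutation is not unique, but the sorted entries are,
   so the definitions below do not depend on the choice made above. *)
Lemma sorting_uniq {R : realType} {N : nat} (Y : 'rV[R]_N) (r s : 'S_N) :
  sorting Y r -> sorting Y s -> forall i, Y 0 (r i) = Y 0 (s i).
Proof.
move=> Yr Ys.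
have entriesP (u : 'S_N) :
    perm_eq [seq Y 0 (u i) | i <- enum 'I_N] [seq Y 0 i | i <- enum 'I_N].
  rewrite (map_comp (fun i => Y 0 i) u); apply: perm_map.
  apply: uniq_perm; rewrite ?(map_inj_uniq perm_inj) ?enum_uniq// => i.
  by rewrite mem_enum -{1}(permKV u i) map_f ?mem_enum.
have : [seq Y 0 (r i) | i <- enum 'I_N] = [seq Y 0 (s i) | i <- enum 'I_N].
  apply: (sorted_eq le_trans le_anti Yr Ys).
  by rewrite (permPl (entriesP r)) perm_sym.
by move/eq_in_map => rs i; apply: rs; rewrite mem_enum.
Qed.

(* Piecewise linear interpolation, on [0, 1], of the points (k / N, c k) for
   k = 0, ..., N.  At t = 1 the index k is N and c N.+1 gets weight 0. *)
Definition interpolation {R : realType} (N : nat) (c : nat -> R) (t : R) : R :=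
  let k := Num.truncn (N%:R * t) in
  line_path (c k) (c k.+1) (factor (k%:R / N%:R) (k.+1%:R / N%:R) t).

Lemma interpolationE {R : realType} (N : nat) (c : nat -> R) (k : nat) (t : R) :
  (k < N)%N -> k%:R / N%:R <= t <= k.+1%:R / N%:R ->
  interpolation N c t =
    line_path (c k) (c k.+1) (factor (k%:R / N%:R) (k.+1%:R / N%:R) t).
Proof.
move=> kN /andP[kt tk].
have N0 : 0 < N%:R :> R by rewrite ltr0n (leq_ltn_trans _ kN).
have facE j : factor (j%:R / N%:R) (j.+1%:R / N%:R) t = N%:R * t - j%:R :> R.
  rewrite /factor -mulrBl -natrB// subSnn div1r invrK mulrBl divfK ?gt_eqF//.
  by rewrite mulrC.
have [tlt|tge] := ltP t (k.+1%:R / N%:R).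
  rewrite /interpolation (@truncn_def _ _ k)//.
  by rewrite mulrC -ler_pdivrMr// kt -ltr_pdivlMr.
have tE : N%:R * t = k.+1%:R.
  by apply/eqP; rewrite mulrC eq_le -ler_pdivlMr// tk -ler_pdivrMr.
rewrite /interpolation tE natrK !facE tE subrr line_path0.
by rewrite -natrB// subSnn line_path1.
Qed.

Definition lorenz {R : realType} {N : nat} (Y : 'rV[R]_N) : R -> R :=
  interpolation N
    (fun k => \sum_(i < N | (i < k)%N) Y 0 (sorting_perm Y i)).

Definition dual_lorenz {R : realType} {N : nat} (Y : 'rV[R]_N) : R -> R :=
  interpolation N
    (fun k => \sum_(i < N | (i < k)%N) Y 0 (sorting_perm Y (rev_ord i))).

Definition mean {R : realType} {N : nat} (Y : 'rV[R]_N) : R :=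
  N%:R^-1 * \sum_(i < N) Y 0 i.

Definition S_index {R : realType} (p : R) {N : nat} (Y : 'rV[R]_N) : R :=
  (N%:R * mean Y)^-1 *
  (\int[@lebesgue_measure R]_(t in `[0, 1])
     (`|dual_lorenz Y t - lorenz Y t| `^ p)) `^ p^-1.

Lemma half_ord_subproof (N : nat) (i : 'I_(N + N)) : (i./2 < N)%N.
Proof. by rewrite ltn_half_double -addnn. Qed.

Definition half_ord (N : nat) (i : 'I_(N + N)) : 'I_N :=
  Ordinal (half_ord_subproof i).

(* (Y_1, Y_1, Y_2, Y_2, ..., Y_N, Y_N); the length 2N is written N + N, as in
   the type of row_mx Y Y. *)
Definition duplicate_entries {R : realType} {N : nat} (Y : 'rV[R]_N) :
    'rV[R]_(N + N) :=
  \row_(i < N + N) Y 0 (half_ord i).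

(* Main.v *)
Require Import Defs.
From HB Require Import structures.
From mathcomp Require Import all_boot all_order all_algebra all_fingroup.
From mathcomp Require Import all_classical all_reals all_analysis.
From mathcomp Require Import measurable_realfun zify ring lra.
Import Order.TTheory GRing.Theory Num.Theory.
Local Open Scope ring_scope.

(* For t >= 0 the interpolation of the partial sums of y_0, ..., y_(N-1) equals
   the sum over i of y_i * clamp (N t - i), where clamp is the projection of R
   onto [0, 1].  The sorted entries of a vector in which every entry of Y occurs
   twice as often are z_j = y_(j./2), so the identity
   clamp (2x) + clamp (2x - 1) = 2 clamp x shows that both of its Lorenz curves
   are twice those of Y.  This factor 2 cancels against the one in the total. *)

Definition clamp {R : realType} (x : R) : R := Num.max 0 (Num.min 1 x).

Lemma clamp_le0 (R : realType) (x : R) : x <= 0 -> clamp x = 0.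
Proof. by move=> x0; rewrite /clamp max_l// ge_min x0 orbT. Qed.

Lemma clamp_id (R : realType) (x : R) : 0 <= x <= 1 -> clamp x = x.
Proof. by move=> /andP[x0 x1]; rewrite /clamp (min_r x1) max_r. Qed.

Lemma clamp_ge1 (R : realType) (x : R) : 1 <= x -> clamp x = 1.
Proof. by move=> x1; rewrite /clamp min_l// max_r. Qed.

(** As [x] crosses [0, 1], the first summand rises from 0 to 1 on the first half and the second on
    the other half. *)
Lemma clamp_double (R : realType) (x : R) :
  clamp (2 * x) + clamp (2 * x - 1) = 2 * clamp x.
Proof.
have [x0|x0] := lerP x 0; first by rewrite !clamp_le0; lra.
have [x1|x1] := lerP 1 x; first by rewrite !clamp_ge1; lra.
rewrite (clamp_id _ x); last by lra.
have [xh|xh] := lerP (2 * x) 1.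
  by rewrite clamp_id ?clamp_le0; lra.
by rewrite clamp_ge1 ?clamp_id; lra.
Qed.

(** With [k] the integer part of [N%:R * t], the clamp is 1 for [i < k], 0 for [i > k], and at
    [i = k] it is the interpolation weight [N%:R * t - k%:R]. *)
Lemma interpolation_partial_sums (R : realType) (N : nat) (y : 'I_N -> R) (t : R) :
  (0 < N)%N -> 0 <= t ->
  interpolation N (fun k => \sum_(i < N | (i < k)%N) y i) t =
    \sum_(i < N) y i * clamp (N%:R * t - i%:R).
Proof.
move=> N0 t0; rewrite /interpolation /line_path.
have : 0 <= N%:R * t by rewrite mulr_ge0.
move=> /truncn_itv; set k := Num.truncn _ => /andP[kt tk].
have -> : factor (k%:R / N%:R) (k.+1%:R / N%:R) t = N%:R * t - k%:R.
  have N0' : N%:R != 0 :> R by rewrite pnatr_eq0 -lt0n.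
  by rewrite /factor -mulrBl -natrB// subSnn div1r invrK mulrBl divfK// mulrC.
rewrite 2!(big_mkcond (fun i : 'I_N => (i < _)%N)) !mulr_sumr -big_split.
apply: eq_bigr => i _; move: kt tk; move: (N%:R * t) => u kt tk /=.
rewrite ltnS -natr1 in tk *.
case: (ltngtP i k) => [ik|ki|->].
- have : i.+1%:R <= k%:R :> R by rewrite ler_nat.
  by rewrite -natr1 => ?; rewrite clamp_ge1; [ring | lra].
- have : k.+1%:R <= i%:R :> R by rewrite ler_nat.
  by rewrite -natr1 => ?; rewrite clamp_le0; [ring | lra].
- by rewrite clamp_id; [ring | lra].
Qed.

Lemma measurable_sum_clamp (R : realType) (N : nat) (y : 'I_N -> R) :
  measurable_fun [set: R] (fun t => \sum_(i < N) y i * clamp (N%:R * t - i%:R)).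
Proof.
apply: measurable_sum => i; apply: measurable_funM => //.
apply: measurable_maxr => //; apply: measurable_minr => //.
by apply: measurable_funB => //; apply: measurable_funM.
Qed.

(** The fibre of [half_ord] over [i] is {2i, 2i+1}. The second argument of [F] lets a summand depend
    also on the index itself, as the clamps do. *)
Lemma sum_half_ord (V : nmodType) (N : nat) (F : 'I_N -> nat -> V) :
  \sum_(i < N + N) F (half_ord i) i =
    \sum_(i < N) (F i i.*2 + F i i.*2.+1).
Proof.
have sum_double n (G : nat -> V) :
    \sum_(i < n.*2) G i = \sum_(i < n) (G i.*2 + G i.*2.+1).
  by elim: n => [|n IH]; rewrite ?big_ord0// doubleS !big_ord_recr/= IH addrA.
(* [inord] below makes the summand a function on [nat], as [sum_double] requires; it lands in a
   nonempty ordinal type, hence this case split. *)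
case: N F => [|N] F; first by rewrite !big_ord0.
rewrite (eq_bigr (fun i : 'I_(N.+1 + N.+1) => F (inord i./2) i)) => [|i _].
  rewrite addnn (sum_double _ (fun i => F (inord i./2) i)).
  by apply: eq_bigr => i _; rewrite /= ?doubleK ?uphalf_double inord_val.
by congr F; apply: val_inj; rewrite /= inordK// half_ord_subproof.
Qed.

Lemma perm_half_ord (T : eqType) (N : nat) (g : 'I_N -> T) :
  perm_eq [seq g (half_ord i) | i <- enum 'I_(N + N)]
    ([seq g i | i <- enum 'I_N] ++ [seq g i | i <- enum 'I_N]).
Proof.
apply/seq.permP => a; rewrite count_cat -!sum1_count !big_map -!enumT.
rewrite !big_enum_cond/= big_mkcond.
rewrite (sum_half_ord _ _ (fun i _ => if a (g i) then 1%N else 0%N)).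
by rewrite big_split/= -big_mkcond.
Qed.

Lemma perm_sorting (R : realType) (N : nat) (Y : 'rV[R]_N) (s : 'S_N) :
  perm_eq [seq Y 0 (s i) | i <- enum 'I_N] [seq Y 0 i | i <- enum 'I_N].
Proof.
rewrite (map_comp (fun i => Y 0 i) s); apply/perm_map/uniq_perm.
- by rewrite (map_inj_uniq perm_inj) enum_uniq.
- exact: enum_uniq.
- by move=> i; rewrite mem_enum -{1}(permKV s i) map_f ?mem_enum.
Qed.

(** Both clonings satisfy this multiset relation, so a single argument about [Z] covers them. *)
Definition doubles {R : realType} {N : nat} (Y : 'rV[R]_N) (Z : 'rV[R]_(N + N)) :=
  perm_eq [seq Z 0 i | i <- enum 'I_(N + N)]
    ([seq Y 0 i | i <- enum 'I_N] ++ [seq Y 0 i | i <- enum 'I_N]).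

Lemma doubles_duplicate_entries (R : realType) (N : nat) (Y : 'rV[R]_N) :
  doubles Y (duplicate_entries Y).
Proof.
rewrite /doubles (eq_map (g := fun i => Y 0 (half_ord i))) => [|i].
  exact: (perm_half_ord _ _ (fun i => Y 0 i)).
by rewrite mxE.
Qed.

Lemma doubles_row_mx (R : realType) (N : nat) (Y : 'rV[R]_N) :
  doubles Y (row_mx Y Y).
Proof.
apply/seq.permP => a; rewrite count_cat -!sum1_count !big_map -!enumT !big_enum_cond/=.
rewrite big_split_ord/=.
by congr (_ + _)%N; apply: eq_bigl => i; rewrite ?row_mxEl ?row_mxEr.
Qed.

Section Doubling.
Variables (R : realType) (N : nat) (Y : 'rV[R]_N) (Z : 'rV[R]_(N + N)).
Hypotheses (N0 : (0 < N)%N) (YZ : doubles Y Z).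

(** Both families list the same multiset in nondecreasing order, and such a list is unique. *)
Lemma sorting_perm_doubles (i : 'I_(N + N)) :
  Z 0 (sorting_perm Z i) = Y 0 (sorting_perm Y (half_ord i)).
Proof.
suff /eq_in_map : [seq Z 0 (sorting_perm Z i) | i <- enum 'I_(N + N)] =
    [seq Y 0 (sorting_perm Y (half_ord i)) | i <- enum 'I_(N + N)].
  by apply; rewrite mem_enum.
apply: (sorted_eq le_trans le_anti (sorting_permP Z)); last first.
  rewrite (permPl (perm_sorting _ _ _ _)) (permPl YZ) perm_sym.
  rewrite (permPl (perm_half_ord _ _ (fun i => Y 0 (sorting_perm Y i)))).
  by rewrite perm_cat// perm_sorting.
have mono (a b : 'I_N) : (a <= b)%N ->
    Y 0 (sorting_perm Y a) <= Y 0 (sorting_perm Y b).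
  move=> ab; have := sorting_permP Y; rewrite /sorting => sY.
  have := sorted_leq_nth le_trans le_refl (Y 0 a) sY.
  move=> /(_ a b); rewrite !inE size_map size_enum_ord !ltn_ord => /(_ _ _ ab).
  rewrite !(nth_map a (Y 0 a) (fun i => Y 0 (sorting_perm Y i))) ?size_enum_ord//.
  by rewrite !nth_ord_enum; apply.
(* The enumeration is strictly increasing, and both halving and [mono] preserve order. *)
rewrite sorted_map; have : sorted ltn (map val (enum 'I_(N + N))).
  by rewrite val_enum_ord iota_ltn_sorted.
rewrite sorted_map; apply: sub_sorted => a b /= ab.
by apply: mono; rewrite /= half_leq// ltnW.
Qed.

(** The terms of index 2i and 2i+1 share the weight [y i], and their clamps are those of
    [clamp_double] at [x = N%:R * t - i%:R]. *)
Lemma interpolation_doubles (y : 'I_N -> R) (t : R) : 0 <= t ->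
  interpolation (N + N)
    (fun k => \sum_(i < N + N | (i < k)%N) y (half_ord i)) t =
  2 * interpolation N (fun k => \sum_(i < N | (i < k)%N) y i) t.
Proof.
move=> t0; rewrite !interpolation_partial_sums ?addn_gt0 ?N0//.
rewrite (sum_half_ord _ _ (fun i j => y i * clamp ((N + N)%:R * t - j%:R))).
rewrite mulr_sumr; apply: eq_bigr => i _.
rewrite -mulrDr mulrCA -clamp_double; congr (_ * (clamp _ + clamp _)).
  by rewrite -mul2n natrD; ring.
by rewrite -natr1 -mul2n natrD; ring.
Qed.

Lemma lorenz_doubles (t : R) : 0 <= t -> lorenz Z t = 2 * lorenz Y t.
Proof.
move=> t0; rewrite /lorenz -interpolation_doubles//; congr interpolation.
by apply/funext => k; apply: eq_bigr => i _; rewrite sorting_perm_doubles.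
Qed.

Lemma dual_lorenz_doubles (t : R) : 0 <= t ->
  dual_lorenz Z t = 2 * dual_lorenz Y t.
Proof.
move=> t0; rewrite /dual_lorenz.
rewrite -(interpolation_doubles (fun i => Y 0 (sorting_perm Y (rev_ord i))))//.
congr interpolation; apply/funext => k; apply: eq_bigr => i _.
rewrite sorting_perm_doubles; congr (Y 0 (sorting_perm Y _)).
(* Reversal commutes with halving: the integer part of (2N - 1 - i)/2 is N - 1 - [i./2]. *)
by apply: val_inj => /=; have := ltn_ord i; lia.
Qed.

Lemma mean_doubles : (N + N)%:R * mean Z = 2 * (N%:R * mean Y).
Proof.
rewrite /mean !mulVKf ?pnatr_eq0 -?lt0n ?addn_gt0 ?N0//.
have := perm_big _ YZ (op := +%R) (x := 0) (P := xpredT) (F := id).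
by rewrite big_cat/= !big_map -!enumT !big_enum/= => ->; ring.
Qed.

Lemma measurable_lorenz_gap (p : R) :
  measurable_fun (`[0, 1]%classic : set R)
    (fun t => `|dual_lorenz Y t - lorenz Y t| `^ p).
Proof.
have : measurable_fun [set: R] (fun t : R =>
    `|\sum_(i < N) Y 0 (sorting_perm Y (rev_ord i)) * clamp (N%:R * t - i%:R) -
      \sum_(i < N) Y 0 (sorting_perm Y i) * clamp (N%:R * t - i%:R)| `^ p).
  apply: (measurableT_comp (measurable_powR p)); apply: measurableT_comp => //.
  by apply: measurable_funB; exact: measurable_sum_clamp.
move=> /(@measurable_funTS _ _ _ _ (`[0, 1]%classic : set R)).
apply: eq_measurable_fun => t; rewrite inE/= in_itv/= => /andP[t0 _].
by rewrite /dual_lorenz /lorenz !interpolation_partial_sums.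
Qed.

Lemma S_index_doubles (p : R) : 0 < p -> S_index p Z = S_index p Y.
Proof.
move=> p0; rewrite /S_index mean_doubles.
set I := (X in _ = _ * (X `^ _)).
have -> : \int[@lebesgue_measure R]_(t in `[0, 1])
    (`|dual_lorenz Z t - lorenz Z t| `^ p) = 2 `^ p * I.
  rewrite /I /Rintegral.
  transitivity (fine (\int[@lebesgue_measure R]_(t in `[0, 1])
      ((2 `^ p)%:E * (`|dual_lorenz Y t - lorenz Y t| `^ p)%:E)%E)).
    congr fine; apply: eq_integral => t; rewrite inE/= in_itv/= => /andP[t0 _].
    rewrite dual_lorenz_doubles// lorenz_doubles// -mulrBr normrM powRM//.
    by rewrite EFinM ger0_norm.
  rewrite ge0_integralZl_EFin ?powR_ge0//=; last first.
    by apply/measurable_EFinP; exact: measurable_lorenz_gap.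
  have c0 : 0 < 2 `^ p :> R by rewrite powR_gt0.
  (* At an infinite value [fine] returns 0, and a positive multiple stays infinite, so both sides
     are 0. *)
  case: (integral _ _ _) => [r||]//=; first by rewrite mulr0 gt0_muley.
  by rewrite mulr0 gt0_muleNy.
have I0 : 0 <= I by apply: Rintegral_ge0 => t _; exact: powR_ge0.
rewrite powRM ?powR_ge0// -powRrM divff ?gt_eqF// powRr1// invfM.
by rewrite mulrACA mulVf ?mul1r.
Qed.

End Doubling.

Theorem proposition3 (R : realType) (p : R) (hp : 0 < p)
    (N : nat) (hN : (1 <= N)%N)
    (Y : 'rV[R]_N) (hY : forall i : 'I_N, 0 < Y 0 i) :
  S_index p Y = S_index p (duplicate_entries Y) /\
  S_index p (duplicate_entries Y) = S_index p (row_mx Y Y).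
Proof.
rewrite (S_index_doubles _ _ Y (row_mx Y Y) hN (doubles_row_mx _ _ Y) _ hp).
by rewrite (S_index_doubles _ _ _ _ hN (doubles_duplicate_entries _ _ Y) _ hp).
Qed.
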